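(* Let $G=(V,E)$ be a directed graph with a legal partition $V_1,\dots,V_m$ and index sets $U_1,U_2$, and run the two-level online stochastic mirror descent algorithm described in the context for $T$ rounds. Let $(\bar k^*,j^* )$ be a fixed arm. (i) If $\bar k^*\in U_2$, then the regret of the algorithm with respect to $(\bar k^*,j^* )$ satisfies $$R_{(\bar k^*,j^* )}(T) \le \Big\{D_{\Psi}(\Delta_{m-1}) + \frac12\sum_{t=1}^T\mathbf E\Big[\sup_{\mathbf y\in [W^{(t)},Y^{(t)}]}\|(\widehat L^{(t)})'\|^2_{\nabla^{-2}\Psi(\mathbf y)}\Big]\Big\}+ \sum_{t=1}^T\sum_{\bar k\in [m]}\sum_{j\in [n_{\bar k}]} \gamma^{(t)}((\bar k,j))$$ $$\qquad+\Big\{\frac{D_{\Phi_{\bar k^*}}(\Delta_{n_{\bar k^*}-1})}{\eta_{\bar k^*}}+\frac{\eta_{\bar k^*}}{2}\sum_{t=1}^T \mathbf E\Big[\sup_{\mathbf x\in [Q^{(t)}_{\bar k^*},X^{(t)}_{\bar k^*}]} \|\hat\ell^{(t)}_{\bar k^*}\|^2_{\nabla^{-2}\Phi_{\bar k^*}(\mathbf x)}\Big]\Big\}+ \sum_{t=1}^T\sum_{j\in [n_{\bar k^*}]}\gamma^{(t)}_{\bar k^*}(j).$$ (ii) If $\bar k^*\in U_1$, then the regret of the algorithm with respect to $(\bar k^*,j^* )$ satisfies $$R_{(\bar k^*,j^* )}(T)\le D_{\Psi}(\Delta_{m-1}) + \sum_{t=1}^T\Big( \frac12\mathbf E\Big[\sup_{\mathbf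 y\in [W^{(t)},Y^{(t)}]}\|(\widehat L^{(t)})'\|^2_{\nabla^{-2}\Psi(\mathbf y)}\Big]+ \sum_{\bar k\in [m]}\sum_{j\in [n_{\bar k}]} \gamma^{(t)}((\bar k,j))\Big).$$ Here $$W^{(t)} = \arg\min_{\mathbf w\in \mathrm{int}(\mathrm{dom}(\Psi))} \langle \mathbf w,(\widehat L^{(t)})'\rangle + B_\Psi(\mathbf w, Y^{(t)}),\qquad Q^{(t)}_{\bar k^*}=\arg\min_{\mathbf q\in \mathrm{int}(\mathrm{dom}(\Phi_{\bar k^*}))}\eta_{\bar k^*}\langle \mathbf q,\hat\ell^{(t)}_{\bar k^*}\rangle + B_{\Phi_{\bar k^*}}(\mathbf q, X^{(t)}_{\bar k^*}).$$
   Context: **Problem (bandit with graph feedback).** $G=(V,E)$ is a directed graph, possibly with self-loops, $|V|=N$; vertices are called arms. $N_{\mathrm{in}}(v)=\{u:(u,v)\in E\}$, $N_{\mathrm{out}}(v)=\{u:(v,u)\in E\}$. The player knows $G$ and the horizon $T$. In each round $t=1,\dots,T$ the player computes a distribution on $V$ and samples an arm $A_t$ from it; the adversary chooses a loss function $\ell^{(t)}:V\to[0,1]$; the player pays $\ell^{(t)}(A_t)$ and observes $\ell^{(t)}(v)$ for $v\in N_{\mathrm{out}}(A_t)$. For a fixed loss sequence $\ell^{(1)},\dots,\ell^{(T)}$ and an arm $a$, the regret is $R_a(T)=\mathbf E[\sum_{t=1}^T\ell^{(t)}(A_t)]-\sum_{t=1}^T\ell^{(t)}(a)$ (expectation over the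 randomness of the algorithm). **Observability.** A vertex $v$ is non-observable if $N_{\mathrm{in}}(v)=\emptyset$, otherwise observable; a graph is observable if it has no non-observable vertex. A vertex $v$ is strongly observable if it has a self-loop or $N_{\mathrm{in}}(v)=V\setminus\{v\}$. **Legal partition.** A partition $V_1,\dots,V_m$ of $V$, with $n_{\bar k}=|V_{\bar k}|$, is legal if every induced subgraph $G[V_{\bar k}]$ is observable and the indices split into $U_1=\{1,\dots,s\}$ and $U_2=\{s+1,\dots,m\}$ ($s=0$ allowed) such that $n_{\bar k}=1$ for all $\bar k\in U_1$, $n_{\bar k}>1$ for all $\bar k\in U_2$, and for every $\bar k\in U_1$ the unique vertex of $V_{\bar k}$ is strongly observable in $G$. $U_1^S\subseteq U_1$ is the set of indices whose vertex has a self-loop, and $U_1^{\overline S}=U_1\setminus U_1^S$. The $j$-th arm of block $V_{\bar k}$ is written $(\bar k,j)$, $j\in[n_{\bar k}]$. **Notation.** $[n]=\{1,\dots,n\}$; $\Delta_{n-1}$ is the probability simplex in $\mathbb R^n$; $\mathbf 1^{[m]}$ is the all-ones vector in $\mathbb R^m$; $[\mathbf a,\mathbf b]$ is the segment between $\mathbf a$ and $\mathbf b$. For a convex function $F:\mathbb R^n\to\mathbb R\cup\{\infty\}$, $\mathrm{dom}(F)=\{\mathbf x:F(\mathbf x)<\infty\}$ is assumed open and $F$ differentiable in it; $B_F(\mathbf x,\mathbf y)=F(\mathbf x)-F(\mathbf y)-\langle\nabla F(\mathbf y),\mathbf x-\mathbf y\rangle$ is the Bregman divergence; $D_F(K)=\max_{\mathbf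 x,\mathbf y\in K}F(\mathbf x)-F(\mathbf y)$. $\|\mathbf x\|_A=\sqrt{\mathbf x^{\mathsf T}A\mathbf x}$, and $\|\mathbf x\|_{\nabla^{-2}F(\mathbf y)}=\|\mathbf x\|_{(\nabla^2F(\mathbf y))^{-1}}$. **Algorithm.** Parameters: a convex potential $\Psi$ on $\mathbb R^m$ and, for $\bar k\in U_2$, a convex potential $\Phi_{\bar k}$ on $\mathbb R^{n_{\bar k}}$ and a step size $\eta_{\bar k}$; global exploration factors $\gamma^{(t)}((\bar k,j))\in[0,1]$ for all arms, with total $\overline\gamma^{(t)}=\sum_{\bar k\in[m]}\sum_{j\in[n_{\bar k}]}\gamma^{(t)}((\bar k,j))$; local exploration factors $\gamma^{(t)}_{\bar k}(j)\in[0,1]$ for $\bar k\in U_2$, $j\in[n_{\bar k}]$, with total $\overline\gamma^{(t)}_{\bar k}=\sum_j\gamma^{(t)}_{\bar k}(j)$. Initialize $Y^{(1)}=\arg\min_{\mathbf y\in\Delta_{m-1}}\Psi(\mathbf y)$, $X^{(1)}_{\bar k}=\arg\min_{\mathbf x\in\Delta_{n_{\bar k}-1}}\Phi_{\bar k}(\mathbf x)$ for $\bar k\in U_2$; for $\bar k\in U_1$, $X^{(t)}_{\bar k}=1$ for all $t$. In round $t=1,\dots,T$: - for $\bar k\in U_2$ set $\tilde X^{(t)}_{\bar k}(j)=(1-\overline\gamma^{(t)}_{\bar k})X^{(t)}_{\bar k}(j)+\gamma^{(t)}_{\bar k}(j)$ and $Z^{(t)}((\bar k,j))=(1-\overline\gamma^{(t)})Y^{(t)}(\bar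 k)\tilde X^{(t)}_{\bar k}(j)+\gamma^{(t)}((\bar k,j))$; for $\bar k\in U_1$ set $Z^{(t)}((\bar k,j))=(1-\overline\gamma^{(t)})Y^{(t)}(\bar k)X^{(t)}_{\bar k}(j)+\gamma^{(t)}((\bar k,j))$ (with $j=1$); - play $A_t\sim Z^{(t)}$, observe the losses of the arms in $N_{\mathrm{out}}(A_t)$, and for every arm set $\hat\ell^{(t)}_{\bar k}(j)=\dfrac{\mathbf 1[(\bar k,j)\in N_{\mathrm{out}}(A_t)]}{\sum_{a\in N_{\mathrm{in}}((\bar k,j))}Z^{(t)}(a)}\,\ell^{(t)}((\bar k,j))$; - set $\widehat L^{(t)}(\bar k)=\sum_{j\in[n_{\bar k}]}\tilde X^{(t)}_{\bar k}(j)\hat\ell^{(t)}_{\bar k}(j)$ for $\bar k\in U_2$ and $\widehat L^{(t)}(\bar k)=\hat\ell^{(t)}_{\bar k}(1)$ for $\bar k\in U_1$; $c^{(t)}=\sum_{\bar k\in U_1^{\overline S}}\widehat L^{(t)}(\bar k)Y^{(t)}(\bar k)$; $(\widehat L^{(t)})'=\widehat L^{(t)}-c^{(t)}\mathbf 1^{[m]}$; - update $X^{(t+1)}_{\bar k}=\arg\min_{\mathbf x\in\Delta_{n_{\bar k}-1}}\eta_{\bar k}\langle\mathbf x,\hat\ell^{(t)}_{\bar k}\rangle+B_{\Phi_{\bar k}}(\mathbf x,X^{(t)}_{\bar k})$ for $\bar k\in U_2$, and $Y^{(t+1)}=\arg\min_{\mathbf y\in\Delta_{m-1}}\langle\mathbf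 y,(\widehat L^{(t)})'\rangle+B_\Psi(\mathbf y,Y^{(t)})$. *)

(* Defs.v *)
From HB Require Import structures.
From mathcomp Require Import all_boot all_order all_algebra.
From mathcomp Require Import all_classical all_reals all_analysis.

Set Implicit Arguments.
Unset Strict Implicit.
Unset Printing Implicit Defensive.

Import Order.TTheory GRing.Theory Num.Theory.
Import numFieldNormedType.Exports.

Local Open Scope classical_set_scope.
Local Open Scope ring_scope.

Section Graph.
Variables (V : finType) (E : rel V).

Definition Nin (v : V) : {set V} := [set u | E u v]%SET.
Definition Nout (v : V) : {set V} := [set u | E v u]%SET.

Definition observable : Prop := forall v, Nin v != finset.set0.

Definition strongly_observable (v : V) : bool :=
  E v v || (Nin v == [set~ v]%SET).
End Graph.

(* A partition of V into blocks V_0, ..., V_(m-1) whose vertices are named    *)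
(* (k, j) with j < bsize k: [arm] sends the name (k, j) to the vertex and     *)
(* [coord] is its inverse.  The first [nU1] indices form U_1, the others U_2. *)
Record named_partition (V : finType) (m : nat) := NamedPartition {
  nU1 : nat;
  bsize : 'I_m -> nat;
  arm : forall k : 'I_m, 'I_(bsize k) -> V;
  coord : V -> {k : 'I_m & 'I_(bsize k)};
  armK : forall k j, coord (@arm k j) = Tagged (fun k => 'I_(bsize k)) j;
  coordK : forall v, arm (tagged (coord v)) = v
}.
Arguments arm {V m} _ {k} _.

Section Partition.
Variables (V : finType) (m : nat) (B : named_partition V m).

Definition block (k : 'I_m) : {set V} := [set arm B j | j : 'I_(bsize B k)]%SET.
Definition inU1 (k : 'I_m) : bool := (k < nU1 B)%N.
Definition inU2 (k : 'I_m) : bool := (nU1 B <= k)%N.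

Definition induced (E : rel V) (A : {set V}) : rel {v : V | v \in A} :=
  relpre val E.

(* Observability of the induced subgraph is asked only of the blocks of U_2:  *)
(* a one-vertex induced subgraph is observable exactly when its vertex has a  *)
(* loop, whereas the blocks of U_1 may also consist of a loopless strongly    *)
(* observable vertex (see [U1_noloop]).  Asking it of every block as well is  *)
(* a special case.                                                            *)
Definition legal (E : rel V) : Prop :=
  [/\ (nU1 B <= m)%N,
      forall k, inU2 k -> observable (@induced E (block k)),
      forall k, inU1 k -> bsize B k = 1%N,
      forall k, inU2 k -> (1 < bsize B k)%N &
      forall k v, inU1 k -> v \in block k -> strongly_observable E v].

Definition U1_noloop (E : rel V) (k : 'I_m) : bool :=
  inU1 k && [forall v in block k, ~~ E v v].
End Partition.

Section Potential.
Variables (R : realType) (n : nat).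
Implicit Types (F : 'rV[R]_n -> \bar R) (x y : 'rV[R]_n) (K : set 'rV[R]_n).

Definition simplex : set 'rV[R]_n :=
  [set x | (forall i, 0 <= x 0 i) /\ \sum_i x 0 i = 1].

Definition dotv x y : R := \sum_i x 0 i * y 0 i.

Definition dom F : set 'rV[R]_n := [set x | (F x < +oo)%E].

(* [fine \o F] agrees with F on [dom F]. *)
Definition grad F y : 'rV[R]_n :=
  \row_i ('d (fine \o F) y (delta_mx 0 i : 'rV[R]_n)).

Definition hessian F y : 'M[R]_n := jacobian (grad F) y.

Definition potential F : Prop :=
  [/\ forall x, F x != -oo%E,
      forall x y (t : R), 0 <= t <= 1 ->
        (F (t *: x + (1 - t) *: y)%R <= t%:E * F x + (1 - t)%:E * F y)%E,
      open (dom F) &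
      forall y, dom F y -> differentiable (fine \o F) y].

(* What the notation ||.||_(grad^-2 F(y)) presupposes. *)
Definition invertible_hessian F : Prop :=
  forall y, dom F y -> differentiable (grad F) y /\ hessian F y \in unitmx.

(* +oo when x is not in [dom F]; only used for y in [dom F]. *)
Definition bregman F x y : \bar R :=
  (F x - F y - (dotv (grad F y) (x - y))%:E)%E.

(* Since +oo - +oo = -oo here, pairs of points outside [dom F] do not matter  *)
(* as soon as K meets [dom F]; if in addition K is not included in [dom F],   *)
(* the value is +oo.                                                          *)
Definition diam F K : \bar R :=
  ereal_sup [set (F x - F y)%E | x in K & y in K].

(* As usual for extended-valued functions, there is no minimizer when f is    *)
(* identically +oo on K.                                                      *)
Definition is_argmin K (f : 'rV[R]_n -> \bar R) x : Prop :=
  [/\ K x, (f x < +oo)%E & forall y, K y -> (f x <= f y)%E].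

Definition segment x y : set 'rV[R]_n :=
  [set (1 - t) *: x + t *: y | t in [set t : R | 0 <= t <= 1]].

Definition mxnorm (A : 'M[R]_n) x : R := Num.sqrt ((x *m A *m x^T) 0 0).

Definition sup_sqnorm F x a b : \bar R :=
  ereal_sup [set (mxnorm (invmx (hessian F y)) x ^+ 2)%:E | y in segment a b].
End Potential.
Arguments simplex {R n}.

Record osmd_params (R : realType) (V : finType) (m : nat)
    (B : named_partition V m) := OsmdParams {
  Psi : 'rV[R]_m -> \bar R;
  Phi : forall k : 'I_m, 'rV[R]_(bsize B k) -> \bar R;
  eta : 'I_m -> R;
  gglob : nat -> V -> R;
  gloc : nat -> forall k : 'I_m, 'I_(bsize B k) -> R
}.
Arguments Phi {R V m B} _ _ _.
Arguments gloc {R V m B} _ _ {k} _.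

(* The iterates are functions of the history [:: A_1; ...; A_(t-1)] of the    *)
(* arms played before the current round; rounds are numbered from 0, so that  *)
(* the current round is the size of the history.                              *)
Record iterates (R : realType) (V : finType) (m : nat)
    (B : named_partition V m) := Iterates {
  Yit : seq V -> 'rV[R]_m;
  Xit : seq V -> forall k : 'I_m, 'rV[R]_(bsize B k)
}.
Arguments Xit {R V m B} _ _ _.

Section Algorithm.
Variables (R : realType) (V : finType) (m : nat) (B : named_partition V m).
Variables (E : rel V) (T : nat) (ell : nat -> V -> R).
Variables (P : osmd_params R B) (S : iterates R B).
Implicit Types (h : seq V) (a v : V) (k : 'I_m).

Definition gglob_total (t : nat) : R :=
  \sum_k \sum_(j < bsize B k) gglob P t (arm B j).

Definition gloc_total (t : nat) k : R := \sum_(j < bsize B k) gloc P t j.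

(* The totals are at most 1 because tilde X and Z have to be distributions. *)
Definition valid_parameters : Prop :=
  [/\ potential (Psi P),
      forall k, inU2 B k -> potential (Phi P k) /\ 0 < eta P k,
      forall t v, (t < T)%N -> 0 <= gglob P t v <= 1,
      forall t k (j : 'I_(bsize B k)), (t < T)%N -> inU2 B k ->
        0 <= gloc P t j <= 1 &
      forall t, (t < T)%N ->
        gglob_total t <= 1 /\ forall k, inU2 B k -> gloc_total t k <= 1].

(* tilde X for k in U_2, and the constant 1 for k in U_1. *)
Definition Xtilde h k (j : 'I_(bsize B k)) : R :=
  if inU1 B k then 1
  else (1 - gloc_total (size h) k) * Xit S h k 0 j + gloc P (size h) j.

Definition Z h v : R :=
  (1 - gglob_total (size h)) * Yit S h 0 (tag (coord B v))
    * Xtilde h (tagged (coord B v)) + gglob P (size h) v.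

(* The probability that the first [size h] arms played are those of h. *)
Definition hist_prob h : R :=
  \prod_(i < size h) Z (take i h) (tnth (in_tuple h) i).

Definition lhat h a v : R :=
  (v \in Nout E a)%:R / (\sum_(u in Nin E v) Z h u) * ell (size h) v.

Definition lhat_block h a k : 'rV[R]_(bsize B k) :=
  \row_j lhat h a (arm B j).

Definition Lhat h a : 'rV[R]_m :=
  \row_k \sum_(j < bsize B k) Xtilde h j * lhat h a (arm B j).

Definition cshift h a : R :=
  \sum_(k | U1_noloop B E k) Lhat h a 0 k * Yit S h 0 k.

Definition Lhat' h a : 'rV[R]_m := Lhat h a - cshift h a *: const_mx 1.

Definition Y_objective h a (y : 'rV[R]_m) : \bar R :=
  ((dotv y (Lhat' h a))%:E + bregman (Psi P) y (Yit S h))%E.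

Definition X_objective h a k (x : 'rV[R]_(bsize B k)) : \bar R :=
  ((eta P k * dotv x (lhat_block h a k))%:E
     + bregman (Phi P k) x (Xit S h k))%E.

(* Only histories of positive probability are constrained.  The second item   *)
(* says that the estimators [lhat] never divide by 0.                         *)
Definition is_run : Prop :=
  [/\ is_argmin simplex (Psi P) (Yit S [::]) /\
      (forall k, inU2 B k -> is_argmin simplex (Phi P k) (Xit S [::] k)),
      forall h v, (size h < T)%N -> 0 < hist_prob h ->
        \sum_(u in Nin E v) Z h u != 0 &
      forall h a, (size h < T)%N -> 0 < hist_prob (rcons h a) ->
        is_argmin simplex (Y_objective h a) (Yit S (rcons h a)) /\
        (forall k, inU2 B k ->
           is_argmin simplex (@X_objective h a k) (Xit S (rcons h a) k))].

Definition is_W (W : seq V -> V -> 'rV[R]_m) : Prop :=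
  forall h a, (size h < T)%N -> 0 < hist_prob (rcons h a) ->
    is_argmin (interior (dom (Psi P))) (Y_objective h a) (W h a).

Definition is_Q k (Q : seq V -> V -> 'rV[R]_(bsize B k)) : Prop :=
  forall h a, (size h < T)%N -> 0 < hist_prob (rcons h a) ->
    is_argmin (interior (dom (Phi P k))) (@X_objective h a k) (Q h a).

Definition expect (f : T.-tuple V -> \bar R) : \bar R :=
  (\sum_(w : T.-tuple V) (hist_prob w)%:E * f w)%E.

Definition expect_round (t : 'I_T) (f : seq V -> V -> \bar R) : \bar R :=
  expect (fun w => f (take t w) (tnth w t)).

Definition regret a : \bar R :=
  (expect (fun w => (\sum_(t < T) ell t (tnth w t))%:E)
     - (\sum_(t < T) ell t a)%:E)%E.
End Algorithm.

(* Main.v *)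
(** Each level is mirror descent on a simplex. Comparing the iterate with the
    unconstrained minimizer w of the same step gives the one-step bound
      <x - u, l> <= (B(u, x) - B(u, x')) / eta + (<x - w, l> - B(w, x) / eta);
    by Taylor's formula B(w, x) is half the Hessian form of w - x at a point of
    the segment [w, x], and Young's inequality bounds the last term by
    eta / 2 times the squared dual norm of l. Young's inequality uses that the
    Hessian is symmetric, which twice differentiability already implies.
    The divergences telescope along every history of positive probability.
    Since the loss estimators are conditionally unbiased and the shift c is
    invisible to differences of points of the simplex, the regret is the
    expectation of the sum of the regrets of the two levels, up to the
    exploration terms. *)
Require Import Defs.
From mathcomp Require Import all_boot all_order all_algebra.
From mathcomp Require Import all_classical all_reals all_analysis.
From mathcomp Require Import ring lra.
Import Order.TTheory GRing.Theory Num.Theory.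
Import numFieldNormedType.Exports.
Set Implicit Arguments.
Unset Strict Implicit.
Unset Printing Implicit Defensive.
Local Open Scope classical_set_scope.
Local Open Scope ring_scope.

(** * Directional derivatives along lines *)

Lemma is_derive_cvg (R : numFieldType) (V W : normedModType R) (f : V -> W)
    x v df :
  is_derive x v f df <->
  h^-1 *: (f (h *: v + x) - f x) @[h --> 0^'] --> df.
Proof.
split=> [[fx <-] //|fx].
by apply: DeriveDef; [apply: cvgP fx|apply: cvg_lim fx].
Qed.

Lemma is_derive_line (R : numFieldType) (V W : normedModType R) (f : V -> W)
    x v df (t : R) :
  is_derive (x + t *: v) v f df ->
  is_derive t (1 : R) (fun s : R => f (x + s *: v)) df.
Proof.
move=> /is_derive_cvg fx; apply/is_derive_cvg.
under eq_fun do rewrite scaler1 scalerDl addrCA.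
exact: fx.
Qed.

(** The derivative is in particular the limit of the slopes from the right, so a bound on these near
    0 is enough. Convexity and minimality give information on such one-sided intervals only. *)
Lemma derive_le_slope (R : realType) (g : R -> R) (d c e : R) : 0 < e ->
  is_derive (0 : R) (1 : R) g d ->
  (forall t, 0 < t < e -> g t - g 0 <= t * c) -> d <= c.
Proof.
move=> e0 /is_derive_cvg /cvg_dnbhs_at_right gd gc; apply: cvgr_to_le gd _.
near=> h; have h0 : 0 < h by [].
rewrite scaler1 addr0 ler_pdivrMl ?gc// h0/=.
by near: h; apply: nbhs_right_lt.
Unshelve. all: end_near. Qed.

(** * The scalar product of row vectors *)

Section DotProduct.
Variables (R : realType) (n : nat).
Implicit Types x y z : 'rV[R]_n.

Lemma dotvC x y : dotv x y = dotv y x.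
Proof. by apply: eq_bigr => i _; rewrite mulrC. Qed.

Lemma dotvE x y : dotv x y = (x *m y^T) 0 0.
Proof. by rewrite mxE; apply: eq_bigr => i _; rewrite !mxE. Qed.

Lemma dotvDl x y z : dotv (x + y) z = dotv x z + dotv y z.
Proof. by rewrite !dotvE mulmxDl mxE. Qed.

Lemma dotvZl (a : R) x y : dotv (a *: x) y = a * dotv x y.
Proof. by rewrite !dotvE -scalemxAl mxE. Qed.

Lemma dotvZr (a : R) x y : dotv x (a *: y) = a * dotv x y.
Proof. by rewrite !(dotvC x) dotvZl. Qed.

Lemma dotvBl x y z : dotv (x - y) z = dotv x z - dotv y z.
Proof. by rewrite dotvDl -scaleN1r dotvZl mulN1r. Qed.

Lemma dotvBr x y z : dotv z (x - y) = dotv z x - dotv z y.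
Proof. by rewrite !(dotvC z) dotvBl. Qed.

Lemma continuous_dotv y : continuous (fun x => dotv x y).
Proof.
apply: continuous_big => [|i _ x]; first exact: add_continuous.
by apply: (@continuousM _ 'rV[R]_n);
  [exact: coord_continuous|exact: cst_continuous].
Qed.

Lemma is_derive_dotv (V : normedModType R) (G : V -> 'rV[R]_n) (p q : V) dG z :
  is_derive p q G dG ->
  is_derive p q (fun u => dotv (G u) z) (dotv dG z).
Proof.
move=> /is_derive_cvg Gx; apply/is_derive_cvg.
under eq_fun do rewrite -dotvBl -[_ *: _]dotvZl.
apply: (@cvg_comp _ _ _ _ (fun w => dotv w z) _ _ _ Gx).
exact: continuous_dotv.
Qed.

(** The norm of row vectors is the maximum norm, whose dual is the sum of absolute values. *)
Lemma ler_norm_dotv x y : `|dotv x y| <= `|x| * \sum_i `|y 0 i|.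
Proof.
rewrite mulr_sumr; apply: le_trans (ler_norm_sum _ _ _) _.
apply: ler_sum => i _; rewrite normrM ler_wpM2r//.
rewrite /Num.Def.normr/= mx_normrE.
exact: (le_bigmax _ (fun ij => `|x ij.1 ij.2|) (0, i)).
Qed.

End DotProduct.

(** * Convex potentials, Bregman divergences and first-order optimality *)

Section Potential.
Variables (R : realType) (n : nat) (F : 'rV[R]_n -> \bar R).
Hypothesis pF : potential F.
Implicit Types x y u v : 'rV[R]_n.

Local Notation f := (fine \o F).

Lemma dom_fine x : dom F x -> F x = (f x)%:E.
Proof.
have [nF _ _ _] := pF => Fx; rewrite fineK// fin_numE nF/=.
by rewrite lt_eqF.
Qed.

Lemma open_dom : open (dom F). Proof. by case: pF. Qed.

Lemma is_derive_grad x v : dom F x -> is_derive x v f (dotv (grad F x) v).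
Proof.
move=> Fx; have [_ _ _ /(_ _ Fx) df] := pF.
apply: DeriveDef; first exact: diff_derivable.
rewrite deriveE// /dotv {1}[v]row_sum_delta linear_sum.
by apply: eq_bigr => i _; rewrite linearZ mxE mulrC.
Qed.

Lemma dom_line x v : dom F x -> exists2 d : R, 0 < d &
  forall s : R, `|s| < d -> dom F (x + s *: v).
Proof.
move=> Fx; have : \forall y \near x, dom F y by apply: open_dom.
move=> nF; have : \forall s \near (0 : R), dom F (x + s *: v).
  suff : (fun s : R => x + s *: v) @ 0 --> x + 0 *: v.
    by rewrite scale0r addr0 => /(_ _ nF).
  by apply: cvgD; [exact: cvg_cst|apply: cvgZl; exact: cvg_id].
move=> /nbhs_ballP[d /= d0 dF]; exists d => // s sd; apply: dF.
by rewrite /ball/= sub0r normrN.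
Qed.

Lemma segmentP x y z : segment x y z <->
  exists2 t : R, 0 <= t <= 1 & z = x + t *: (y - x).
Proof.
split=> [[t /= t01 <-]|[t t01 ->]]; exists t => //;
  by rewrite scalerBl scalerBr scale1r addrA addrAC.
Qed.

Lemma dom_segment x y z : dom F x -> dom F y -> segment x y z -> dom F z.
Proof.
have [_ cF _ _] := pF => Fx Fy [t t01 <-] /=; rewrite /dom/=.
have := cF y x t t01; rewrite addrC => /le_lt_trans; apply.
by rewrite (dom_fine Fx) (dom_fine Fy) -!EFinM -EFinD ltry.
Qed.

Lemma convex_line x u (t : R) : dom F x -> dom F u -> 0 <= t <= 1 ->
  f (x + t *: (u - x)) <= f x + t * (f u - f x).
Proof.
move=> Fx Fu t01; have [_ cF _ _] := pF.
have Fz : dom F (x + t *: (u - x)).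
  by apply: (dom_segment Fx Fu); apply/segmentP; exists t.
have := cF u x t t01.
rewrite (_ : t *: u + (1 - t) *: x = x + t *: (u - x)); last first.
  by rewrite scalerBr scalerBl scale1r addrCA.
rewrite (dom_fine Fx) (dom_fine Fu) (dom_fine Fz) -!EFinM -EFinD lee_fin.
by move=> /le_trans; apply; rewrite le_eqVlt; apply/orP; left; apply/eqP; ring.
Qed.

(** Real-valued counterpart of [bregman], open to [ring] and [lra]; only meaningful for two points
    of [dom F]. *)
Definition rbregman x y : R := f x - f y - dotv (grad F y) (x - y).

Lemma bregman_fine x y : dom F x -> dom F y ->
  bregman F x y = (rbregman x y)%:E.
Proof. by move=> Fx Fy; rewrite /bregman (dom_fine Fx) (dom_fine Fy). Qed.

Lemma bregman_dom x y : dom F y -> (bregman F x y < +oo)%E -> dom F x.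
Proof.
move=> Fy; rewrite /bregman (dom_fine Fy) /dom/=.
by have [nF _ _ _] := pF; case: (F x) (nF x) => //= r _ _; rewrite ltry.
Qed.

(** By convexity the slopes at [y] in direction [x - y] are at most that of the chord, hence so is
    the directional derivative. *)
Lemma rbregman_ge0 x y : dom F x -> dom F y -> 0 <= rbregman x y.
Proof.
move=> Fx Fy; rewrite /rbregman subr_ge0.
apply: (@derive_le_slope _ (fun t => f (y + t *: (x - y))) _ _ 1) => //.
  by apply: is_derive_line; rewrite scale0r addr0; apply: is_derive_grad.
move=> t /andP[t0 t1]; rewrite scale0r addr0 lerBlDl.
by apply: convex_line => //; rewrite !ltW.
Qed.

(** All values of [f] cancel. The identity turns the gradient inequality of a mirror step into
    divergences that telescope. *)
Lemma three_point x y u :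
  rbregman u y - rbregman u x - rbregman x y =
  dotv (grad F x - grad F y) (u - x).
Proof.
rewrite /rbregman; move: (grad F x) (grad F y) => a b.
by rewrite dotvBl !dotvBr; ring.
Qed.

(** The derivative at [x] of the minimized function, taken towards [u], cannot be negative. The
    linear part [l] absorbs the loss and the gradient term of a divergence. *)
Lemma argmin_first_order (K : set 'rV[R]_n) x u l :
  dom F x -> segment x u `<=` K ->
  (forall y, K y -> dom F y -> dotv x l + f x <= dotv y l + f y) ->
  0 <= dotv (l + grad F x) (u - x).
Proof.
move=> Fx xuK xmin; rewrite -oppr_le0.
have [e e0 eF] := dom_line (u - x) Fx.
pose g t : R := - (dotv (x + t *: (u - x)) l + f (x + t *: (u - x))).
(* The objective is negated to fit an upper bound on slopes. The bound [e] keeps the moving point in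
   [dom F], the bound 1 keeps it on the segment and hence in [K]. *)
apply: (@derive_le_slope _ g _ _ (Num.min e 1)); first by rewrite lt_min e0/=.
  apply: is_deriveN; rewrite dotvDl; apply: is_deriveD.
    apply: (is_derive_line (f := fun z => dotv z l)); rewrite dotvC.
    exact: (is_derive_dotv (G := id) l (is_derive_id _ (u - x))).
  by apply: is_derive_line; rewrite scale0r addr0; apply: is_derive_grad.
move=> t /andP[t0]; rewrite lt_min => /andP[te t1].
rewrite mulr0 /g scale0r addr0 opprK addrC subr_le0.
apply: xmin; last by apply: eF; rewrite gtr0_norm.
by apply/xuK/segmentP; exists t => //; rewrite !ltW.
Qed.

(** * The Hessian: positivity, symmetry, Taylor's formula and Young's inequality *)

Section Hessian.
Hypothesis iF : invertible_hessian F.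

Lemma is_derive_grad_line x v t : dom F (x + t *: v) ->
  is_derive t (1 : R) (fun s : R => dotv (grad F (x + s *: v)) v)
    (dotv (v *m hessian F (x + t *: v)) v).
Proof.
move=> Fx; have [dG _] := iF Fx; apply: is_derive_dotv.
apply: is_derive_line; apply: DeriveDef; first exact: diff_derivable.
exact: deriveEjacobian.
Qed.

(** Adding the two nonnegative divergences between [x] and [x + t *: v] shows that the gradient is
    monotone along [v]; the form is the derivative of this monotone function. *)
Lemma hessian_ge0 x v : dom F x -> 0 <= dotv (v *m hessian F x) v.
Proof.
move=> Fx; have [e e0 eF] := dom_line v Fx; rewrite -oppr_le0.
pose g t := - dotv (grad F (x + t *: v)) v.
apply: (@derive_le_slope _ g _ _ e) => //.
  have := @is_derive_grad_line x v 0; rewrite scale0r addr0 => /(_ Fx).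
  exact: is_deriveN.
rewrite /g => t /andP[t0 te]; rewrite scale0r addr0 mulr0 opprK addrC.
rewrite subr_le0 -subr_ge0.
have : dom F (x + t *: v) by apply: eF; rewrite gtr0_norm.
have : t *: v = (x + t *: v) - x by rewrite addrAC subrr add0r.
rewrite -(pmulr_rge0 _ t0); move: (x + t *: v) => y vE Fy.
have := rbregman_ge0 Fy Fx; have := rbregman_ge0 Fx Fy; rewrite /rbregman.
move: (grad F x) (grad F y) => a b.
by rewrite mulrBr -(dotvZr t a) -(dotvZr t b) vE !dotvBr; lra.
Qed.

(** The mixed second difference: it is visibly symmetric in [u] and [v], and its leading term is the
    Hessian form. *)
Definition second_diff x u v : R := f (x + u + v) - f (x + u) - f (x + v) + f x.

Lemma second_diffC x u v : second_diff x u v = second_diff x v u.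
Proof. by rewrite /second_diff (addrAC x); ring. Qed.

(* The mean value theorem along u leaves a difference of two gradients at
   points near x, to which differentiability of the gradient at x applies; no
   continuity of the Hessian is needed. *)
Lemma second_diff_hessian x u v (e : R) : dom F x -> 0 < e ->
  exists2 d : R, 0 < d & forall s : R, 0 < s < d ->
  `|second_diff x (s *: u) (s *: v) - s ^+ 2 * dotv (v *m hessian F x) u|
    <= s ^+ 2 * e.
Proof.
move=> Fx e0; have [dG _] := iF Fx.
pose C : R := 1 + \sum_i `|u 0 i|; pose M : R := 1 + `|u| + `|v|.
have C0 : 0 < C by rewrite ltr_pwDl// sumr_ge0.
have M0 : 0 < M by rewrite !ltr_pwDl// ?addr_ge0.
(* Two remainders of the gradient, each at most [e' * (s * M)], are paired with [u] at a cost of at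
   most [C]; the total is then [s * e]. *)
pose e' := e / (2 * M * C).
have e'0 : 0 < e' by rewrite divr_gt0// !mulr_gt0.
pose r h : 'rV[R]_n := grad F (h + x) - grad F x - h *m hessian F x.
have nr : \forall h \near (0 : 'rV[R]_n), `|r h| <= e' * `|h|.
  have [_ /eqaddoP/(_ _ e'0)] := (diff_locallyP x (grad F)).1 dG.
  apply: filterS => h; rewrite !fctE /= opprD addrA.
  by rewrite -(deriveE _ dG) deriveEjacobian.
have nF : \forall h \near (0 : 'rV[R]_n), dom F (h + x).
  have : \forall z \near x, dom F z by apply: open_dom.
  by rewrite (near_shift 0) subr0.
have [d /= d0 dP] : exists2 d : R, 0 < d &
    forall h : 'rV[R]_n, `|h| < d -> `|r h| <= e' * `|h| /\ dom F (h + x).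
  have /nbhs_ballP[d /= d0 dP] : nbhs (0 : 'rV[R]_n)
      [set h | `|r h| <= e' * `|h| /\ dom F (h + x)] by exact: filterI nr nF.
  exists d => // h hd; apply: dP.
  by rewrite -ball_normE/= sub0r normrN.
exists (d / M) => [|s /andP[s0 sd]]; first exact: divr_gt0.
have small (t : R) : 0 <= t <= s ->
    `|t *: u + s *: v| <= s * M /\ `|t *: u| <= s * M.
  move=> /andP[t0 ts].
  have tu : `|t *: u| <= s * `|u| by rewrite normrZ ger0_norm// ler_wpM2r.
  split.
    apply: (le_trans (ler_normD _ _)); apply: (le_trans (lerD tu (lexx _))).
    by rewrite normrZ gtr0_norm// -mulrDr ler_pM2l// /M; lra.
  apply: (le_trans tu); rewrite ler_pM2l// /M.
  by have := normr_ge0 v; lra.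
have sMd : s * M < d by rewrite -ltr_pdivlMr.
have good (t : R) : 0 <= t <= s ->
    [/\ dom F (x + s *: v + t *: u), dom F (x + t *: u) &
      `|dotv (grad F (x + s *: v + t *: u) - grad F (x + t *: u)) u
        - s * dotv (v *m hessian F x) u| <= s * e].
  move=> /small[h1 h2].
  have [r1 F1] := dP _ (le_lt_trans h1 sMd).
  have [r2 F2] := dP _ (le_lt_trans h2 sMd).
  have E1 : x + s *: v + t *: u = t *: u + s *: v + x.
    by rewrite addrC (addrC x) addrA.
  have E2 : x + t *: u = t *: u + x by rewrite addrC.
  rewrite E1 E2; split=> //.
  rewrite -dotvZl -dotvBl.
  have -> : grad F (t *: u + s *: v + x) - grad F (t *: u + x)
       - s *: (v *m hessian F x) = r (t *: u + s *: v) - r (t *: u).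
    rewrite /r mulmxDl -!scalemxAl.
    move: (grad F (_ + _ + x)) (grad F (t *: u + x)) (grad F x) => a b c.
    move: (t *: (u *m _)) (s *: (v *m _)) => p q.
    by apply/rowP => i; rewrite !mxE; ring.
  apply: (le_trans (ler_norm_dotv _ _)).
  apply: (@le_trans _ _ ((2 * e' * (s * M)) * C)).
    apply: ler_pM => //; first by rewrite sumr_ge0.
      apply: (le_trans (ler_normB _ _)); apply: (le_trans (lerD r1 r2)).
      by rewrite -mulrDr -mulrA mulrCA ler_pM2l//; lra.
    by rewrite /C lerDr.
  rewrite le_eqVlt; apply/orP; left; apply/eqP; rewrite /e'.
  by field; rewrite !gt_eqF.
pose g t := f (x + s *: v + t *: u) - f (x + t *: u).
pose dg t := dotv (grad F (x + s *: v + t *: u) - grad F (x + t *: u)) u.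
have dgP t : 0 <= t <= s -> is_derive t (1 : R) g (dg t).
  move=> /good[F1 F2 _]; rewrite /dg dotvBl.
  by apply: is_deriveB; apply: (is_derive_line (f := f)); apply: is_derive_grad.
have [||t /[!in_itv]/= /andP[t0 ts]] := MVT s0 (f := g) (df := dg).
- by move=> t /[!in_itv]/= /andP[t0 ts]; apply: dgP; rewrite !ltW.
- apply: derivable_within_continuous => t /[!in_itv]/= ts.
  by apply: ex_derive; apply: dgP.
have [|_ _] := good t; first by rewrite !ltW.
rewrite -/(dg t) subr0 => gt gE.
have -> : second_diff x (s *: u) (s *: v) = s * dg t.
  rewrite mulrC -gE /g /second_diff !scale0r !addr0 (addrAC x).
  by ring.
by rewrite expr2 -!mulrA -mulrBr normrM gtr0_norm// ler_pM2l.
Qed.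

(** Schwarz's theorem: for small [s] the same second difference, divided by [s ^+ 2], is within
    [e / 2] of either side. *)
Lemma hessian_sym x u v : dom F x ->
  dotv (u *m hessian F x) v = dotv (v *m hessian F x) u.
Proof.
move=> Fx; apply/eqP; rewrite -subr_eq0 -normr_le0; apply/ler_addgt0Pr => e e0.
rewrite add0r.
have e20 : 0 < e / 2 by rewrite divr_gt0.
have [d1 d10 P1] := second_diff_hessian u v Fx e20.
have [d2 d20 P2] := second_diff_hessian v u Fx e20.
pose s := Num.min d1 d2 / 2.
have s0 : 0 < s by rewrite divr_gt0// lt_min d10.
have sd : s < Num.min d1 d2.
  by rewrite /s ltr_pdivrMr// ltr_pMr ?lt_min ?d10// ltr1n.
have /P1 : 0 < s < d1 by rewrite s0/= (lt_le_trans sd)// ge_min lexx.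
have /P2 : 0 < s < d2 by rewrite s0/= (lt_le_trans sd)// ge_min lexx orbT.
rewrite (second_diffC x (s *: v)) => A1 A2.
rewrite -(ler_pM2l (exprn_gt0 2 s0)).
rewrite -[s ^+ 2 in X in X <= _]ger0_norm ?sqr_ge0//.
rewrite -normrM.
move: A1 A2; rewrite !ler_norml => /andP[A1 A2] /andP[A3 A4].
by apply/andP; split; nra.
Qed.

(* Rolle's theorem for psi = p + p' q + K q^2, where p t = f (x + t v),
   q t = 1 - t and K is chosen so that psi 0 = psi 1. *)
Lemma taylor_bregman x w : dom F x -> dom F w ->
  exists2 z, segment w x z &
  rbregman w x = 2^-1 * dotv ((w - x) *m hessian F z) (w - x).
Proof.
move=> Fx Fw; set v := w - x.
have Fl (t : R) : 0 <= t <= 1 -> dom F (x + t *: v).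
  by move=> t01; apply: (dom_segment Fx Fw); apply/segmentP; exists t.
pose K := rbregman w x.
pose p (t : R) := f (x + t *: v).
pose dp (t : R) := dotv (grad F (x + t *: v)) v.
pose q : R -> R := cst 1 - id.
pose psi : R -> R := p + dp * q + K *: (q * q).
(* The derivative of [p] cancels against the term of [dp * q] in which [q] is differentiated, so a
   multiple of [1 - t] is left. *)
have dpsi (t : R) : 0 <= t <= 1 -> is_derive t (1 : R) psi
    ((dotv (v *m hessian F (x + t *: v)) v - 2 * K) * (1 - t)).
  move=> /Fl Ft.
  have d0 : is_derive t (1 : R) p (dp t).
    by apply: (is_derive_line (f := f)); apply: is_derive_grad.
  have d1 : is_derive t (1 : R) dp _ := is_derive_grad_line Ft.
  have d2 : is_derive t (1 : R) q (0 - 1) by apply: is_deriveB.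
  have [dv dE] := is_deriveD (is_deriveD d0 (is_deriveM d1 d2))
                             (is_deriveZ K (is_deriveM d2 d2)).
  apply: DeriveDef dv _; rewrite dE -/(dp t) /GRing.scale/= (_ : q t = 1 - t)//.
  by move: (dotv _ v) => h; ring.
have [||||t t01 [_ tE]] := @Rolle R psi 0 1.
- exact: ltr01.
- by move=> t /[!in_itv]/= /andP[t0 t1]; case: (dpsi t) => //; rewrite !ltW.
- apply: derivable_within_continuous => t /[!in_itv]/= t01.
  by case: (dpsi t).
- rewrite /psi !fctE /p /dp /K /rbregman scale0r addr0 scale1r.
  rewrite (_ : x + v = w); last by rewrite addrC subrK.
  have q0 : q 0 = 1 by exact: subr0.
  have q1 : q 1 = 0 by exact: subrr.
  (* Here [a], [b], [c], [d] stand for [f x], [dp 0], [f w], [dp 1]; both ends are equal to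
     [f w]. *)
  have psiE (a b c d : R) : a + b * q 0 + (c - a - b) *: (q 0 * q 0) =
      c + d * q 1 + (c - a - b) *: (q 1 * q 1).
    by rewrite q0 q1 /GRing.scale/=; ring.
  exact: psiE.
move: t01; rewrite in_itv/= => /andP[t0 t1].
have t01 : 0 <= t <= 1 by rewrite !ltW.
exists (x + t *: v).
  exists (1 - t); first by apply/andP; split; lra.
  by rewrite subKr scalerBl scale1r /v scalerBr addrA addrAC addrC addrA addrAC.
have /@derive_val := dpsi t t01; rewrite tE => /esym/eqP.
rewrite mulf_eq0 => /orP[/eqP|/eqP]; last lra.
by rewrite -/K => ?; lra.
Qed.

(** [Num.sqrt] is 0 on negative numbers, so the right-hand side is the positive part of the form. *)
Lemma mxnorm_ge (A : 'M[R]_n) y : (y *m A *m y^T) 0 0 <= mxnorm A y ^+ 2.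
Proof.
rewrite /mxnorm; have [A0|/ltW A0] := leP 0 ((y *m A *m y^T) 0 0).
  by rewrite sqr_sqrtr.
by rewrite (le_trans A0)// sqr_ge0.
Qed.

(** Expand the nonnegative Hessian form at [a - z], where [z] is the image of [b] under the inverse
    Hessian; symmetry makes both cross terms equal to the product of [a] and [b]. *)
Lemma young_hessian x a b : dom F x ->
  dotv a b <= 2^-1 * dotv (a *m hessian F x) a
              + 2^-1 * mxnorm (invmx (hessian F x)) b ^+ 2.
Proof.
move=> Fx; have [_ uH] := iF Fx; set H := hessian F x.
pose z := b *m invmx H; have zH : z *m H = b by rewrite mulmxKV.
have := hessian_ge0 (a - z) Fx; rewrite -/H mulmxBl !dotvBl !dotvBr.
rewrite (hessian_sym a z Fx) zH.
have := mxnorm_ge (invmx H) b; rewrite -dotvE -/z.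
by rewrite (dotvC z) (dotvC b a); lra.
Qed.

End Hessian.
End Potential.

(** * Suprema of squared dual norms over segments *)

Section SupNorm.
Variables (R : realType) (n : nat) (F : 'rV[R]_n -> \bar R).
Implicit Types l a b z : 'rV[R]_n.

Lemma sup_sqnorm_ge l a b z : segment a b z ->
  ((mxnorm (invmx (hessian F z)) l ^+ 2)%:E <= sup_sqnorm F l a b)%E.
Proof. by move=> abz; apply: ereal_sup_ubound; exists z. Qed.

Lemma sup_sqnorm_ge0 l a b : (0 <= sup_sqnorm F l a b)%E.
Proof.
apply: le_trans (@sup_sqnorm_ge l a b a _); first by rewrite lee_fin sqr_ge0.
by apply/segmentP; exists 0; rewrite ?lexx ?ler01// scale0r addr0.
Qed.

End SupNorm.

(** * Deterministic mirror descent over a convex set *)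

Section MirrorDescent.
Variables (R : realType) (n : nat) (F : 'rV[R]_n -> \bar R).
Variables (K : set 'rV[R]_n) (eta : R).
Hypotheses (pF : potential F) (iF : invertible_hessian F).
Hypothesis convK : forall x y, K x -> K y -> segment x y `<=` K.
Hypothesis eta0 : 0 < eta.
Implicit Types x y u w l : 'rV[R]_n.

(** Common form of the two updates: [Y_objective] has step size 1 and [X_objective] has step size
    [eta P k]. *)
Definition step_objective l x y : \bar R :=
  ((eta * dotv y l)%:E + bregman F y x)%E.

Lemma step_objective_fine l x y : dom F x -> dom F y ->
  step_objective l x y = (eta * dotv y l + rbregman F y x)%:E.
Proof. by move=> Fx Fy; rewrite /step_objective bregman_fine. Qed.

Lemma step_dom l x y : dom F x -> (step_objective l x y < +oo)%E -> dom F y.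
Proof.
move=> Fx h; apply: (bregman_dom pF Fx).
by move: h; rewrite /step_objective; 
  case: (bregman F y x) => //= r _; rewrite ltry.
Qed.

Lemma step_argmin_dom (D : set 'rV[R]_n) l x y : dom F x ->
  is_argmin D (step_objective l x) y -> dom F y.
Proof. by move=> Fx [_ /(step_dom Fx)]. Qed.

(** Optimality of [x'] towards [u] and the three-point identity bound the regret of [x'] by a
    difference of divergences minus [rbregman F x' x]. The latter term pays for replacing [x'] by
    [w], and Taylor with Young bounds what remains. *)
Lemma mirror_step x x' w u l : dom F x ->
  is_argmin K (step_objective l x) x' ->
  is_argmin (interior (dom F)) (step_objective l x) w -> K u -> dom F u ->
  ((dotv (x - u) l)%:E <=
    (eta^-1 * (rbregman F u x - rbregman F u x'))%:E
    + (eta / 2)%:E * sup_sqnorm F l w x)%E.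
Proof.
move=> Fx x'min wmin Ku Fu.
have Fx' := step_argmin_dom Fx x'min; have Fw := step_argmin_dom Fx wmin.
have [Kx' _ {}x'min] := x'min; have [_ _ {}wmin] := wmin.
have [z wxz zE] := taylor_bregman pF iF Fx Fw.
have Fz := dom_segment pF Fw Fx wxz.
set s := mxnorm (invmx (hessian F z)) l ^+ 2.
have xw : eta * dotv (x - w) l <= rbregman F w x + eta * (eta / 2 * s).
  (* After multiplication by [eta ^+ 2], this scaling makes the Hessian term exactly the divergence
     given by Taylor's formula. *)
  have := young_hessian pF iF (eta^-1 *: (x - w)) l Fz; rewrite -/s.
  rewrite zE -scalemxAl -[x - w]opprB mulNmx -scaleN1r -[- (_ *m _)]scaleN1r.
  rewrite !dotvZl !dotvZr -(ler_pM2l (exprn_gt0 2 eta0)).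
  move: (dotv _ _) (dotv _ _) => q d qd.
  have -> : eta * (-1 * d) = eta ^+ 2 * (eta^-1 * (-1 * d)).
    by field; rewrite gt_eqF.
  apply: (le_trans qd); rewrite le_eqVlt; apply/orP; left; apply/eqP.
  by field; rewrite gt_eqF.
(* Since [dom F] is open, [x'] itself competes with [w]. *)
have := wmin x'; rewrite (interior_id _).1; last exact: open_dom.
move=> /(_ Fx'); rewrite !step_objective_fine// lee_fin => w_le.
(* Up to a constant, the objective of the step is [F] plus the linear form of
   [eta *: l - grad F x]. *)
have fo : 0 <= dotv (eta *: l - grad F x + grad F x') (u - x').
  apply: (argmin_first_order pF Fx' (convK Kx' Ku)) => y Ky Fy.
  have := x'min y Ky; rewrite !step_objective_fine// lee_fin /rbregman.
  move: (grad F x) => g; rewrite !dotvBr !dotvZr (dotvC _ g) (dotvC _ g).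
  by lra.
have tp := three_point F x' x u.
have sle : ((eta / 2 * s)%:E <= (eta / 2)%:E * sup_sqnorm F l w x)%E.
  rewrite EFinM; apply: lee_wpmul2l; first by rewrite lee_fin divr_ge0// ltW.
  exact: sup_sqnorm_ge.
apply: le_trans (leeD (lexx _) sle); rewrite -EFinD lee_fin.
rewrite -(ler_pM2l eta0) mulrDr mulrA divff ?gt_eqF// mul1r.
move: fo; rewrite -addrA [- _ + _]addrC => fo.
move: fo xw tp w_le; move: (grad F x' - grad F x) (rbregman F) => g br.
by rewrite (dotvDl (eta *: l) g) dotvZl !(dotvC _ l) !dotvBr; lra.
Qed.

Lemma diam_ge x y : K x -> K y -> (F x - F y <= diam F K)%E.
Proof. by move=> Kx Ky; apply: ereal_sup_ubound; exists x => //; exists y. Qed.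

(** The one-step bounds telescope. The last divergence is nonnegative, and the first is at most
    [F u - F (x 0)] by optimality of the starting point. *)
Lemma mirror_descent_regret (T : nat) (x w l : nat -> 'rV[R]_n) u :
  is_argmin K F (x 0%N) ->
  (forall t, (t < T)%N -> is_argmin K (step_objective (l t) (x t)) (x t.+1)) ->
  (forall t, (t < T)%N ->
     is_argmin (interior (dom F)) (step_objective (l t) (x t)) (w t)) ->
  K u ->
  ((\sum_(t < T) dotv (x t - u) (l t))%:E <=
   diam F K * (eta^-1)%:E
   + (eta / 2)%:E * \sum_(t < T) sup_sqnorm F (l t) (w t) (x t))%E.
Proof.
move=> x0min xmin wmin Ku.
have [Kx0 Fx0 {}x0min] := x0min.
have Fx t : (t <= T)%N -> dom F (x t).
  elim: t => [//|t IH] tT; exact: step_argmin_dom (IH (ltnW tT)) (xmin _ tT).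
have d0 : (0 <= (eta / 2)%:E * \sum_(t < T) sup_sqnorm F (l t) (w t) (x t))%E.
  apply: mule_ge0; first by rewrite lee_fin divr_ge0// ltW.
  by apply: sume_ge0 => t _; exact: sup_sqnorm_ge0.
(* If [u] is outside [dom F], the diameter is infinite and the bound is trivial; [d0] excludes a sum
   of opposite infinities. *)
have [Fu|nFu] := pselect (dom F u); last first.
  have Fuy : F u = +oo%E by apply/eqP; rewrite -leye_eq leNgt; apply/negP.
  have -> : diam F K = +oo%E.
    apply/eqP; rewrite -leye_eq; apply: le_trans (diam_ge Ku Kx0).
    by rewrite Fuy (dom_fine pF Fx0).
  rewrite gt0_mulye ?lte_fin ?invr_gt0// addye ?leey//.
  by rewrite gt_eqF// (lt_le_trans _ d0).
have fo : 0 <= dotv (0 + grad F (x 0)) (u - x 0).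
  apply: (argmin_first_order pF Fx0 (convK Kx0 Ku)) => y Ky Fy.
  rewrite -[0](scale0r (0 : 'rV[R]_n)) !dotvZr !mul0r !add0r.
  by have := x0min y Ky; rewrite (dom_fine pF Fy) (dom_fine pF Fx0) lee_fin.
pose b t := rbregman F u (x t).
apply: (@le_trans _ _ (\sum_(t < T) ((eta^-1 * (b t - b t.+1))%:E
    + (eta / 2)%:E * sup_sqnorm F (l t) (w t) (x t)))%E).
  rewrite -sumEFin; apply: lee_sum => t _.
  by apply: mirror_step (xmin _ _) (wmin _ _) _ _ => //; apply/Fx/ltnW.
rewrite big_split/= -ge0_sume_distrr => [|t _]; last exact: sup_sqnorm_ge0.
apply: leeD => //; rewrite sumEFin -mulr_sumr.
have -> : \sum_(t < T) (b t - b t.+1) = b 0%N - b T.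
  rewrite -(big_mkord xpredT (fun t => b t - b t.+1)).
  under eq_bigr do rewrite -opprB.
  by rewrite sumrN telescope_sumr// opprB.
rewrite mulrC EFinM; apply: lee_wpmul2r; first by rewrite lee_fin invr_ge0 ltW.
apply: le_trans (diam_ge Ku Kx0).
rewrite (dom_fine pF Fx0) (dom_fine pF Fu) lee_fin.
have := rbregman_ge0 pF Fu (Fx T (leqnn T)); rewrite -/(b T).
by move: fo; rewrite add0r /b {2}/rbregman; lra.
Qed.

End MirrorDescent.

(** * The simplex, and sums over arms block by block *)

Lemma simplex_convex (R : realType) n (x y : 'rV[R]_n) :
  simplex x -> simplex y -> segment x y `<=` simplex.
Proof.
move=> [x0 x1] [y0 y1] _ [t /andP[t0 t1] <-]; split=> [i|].
  by rewrite !mxE addr_ge0// mulr_ge0// subr_ge0.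
under eq_bigr do rewrite !mxE.
by rewrite big_split/= -!mulr_sumr x1 y1 !mulr1 subrK.
Qed.

Lemma simplex_delta (R : realType) n (i : 'I_n) :
  simplex (delta_mx 0 i : 'rV[R]_n).
Proof.
split=> [j|]; first by rewrite mxE ler0n.
rewrite (bigD1 i)//= big1 => [|j ji]; rewrite mxE !eqxx/= ?addr0//.
by rewrite (negbTE ji).
Qed.

Lemma sum_arms (A : nmodType) (V : finType) m (B : named_partition V m)
    (f : V -> A) :
  \sum_v f v = \sum_k \sum_(j < bsize B k) f (arm B j).
Proof.
rewrite sig_big_dep/= (reindex (fun v => Defs.coord B v))/=.
  by apply: eq_bigr => v _; rewrite coordK.
exists (fun p => arm B (tagged p)) => [v _|[k j] _]; first exact: coordK.
by rewrite armK.
Qed.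

(** * The law of the history, and conditional expectations in one round *)

Section Run.
Variables (R : realType) (V : finType) (m : nat) (B : named_partition V m).
Variables (E : rel V) (T : nat) (ell : nat -> V -> R).
Variables (P : osmd_params R B) (S : iterates R B).
Implicit Types (h : seq V) (a v : V) (k : 'I_m) (n : nat).

Local Notation prob := (hist_prob P S).
Local Notation Z := (Z P S).
Local Notation X h k := (Xit S h k).
Local Notation Y := (Yit S).

(** Real-valued expectation over the first [n] rounds. Leaving [n] free allows induction on rounds;
    [expect] is the case of [T] rounds. *)
Definition mean n (g : seq V -> R) : R := \sum_(w : n.-tuple V) prob w * g w.

Lemma hist_prob_nil : prob [::] = 1. Proof. by rewrite /hist_prob big_ord0. Qed.

Lemma hist_prob_rcons h a : prob (rcons h a) = prob h * Z h a.
Proof.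
rewrite /hist_prob.
under eq_bigr do rewrite (tnth_nth a) /=.
rewrite size_rcons big_ord_recr/= -cats1 take_size_cat// nth_cat ltnn subnn.
congr (_ * _); apply: eq_bigr => i _.
by rewrite takel_cat 1?ltnW// nth_cat ltn_ord (tnth_nth a).
Qed.

(** The tower property: condition on the first [n] arms and average over the next one. *)
Lemma mean_rcons n g :
  mean n.+1 g = mean n (fun h => \sum_a Z h a * g (rcons h a)).
Proof.
rewrite /mean.
under [RHS]eq_bigr do rewrite mulr_sumr.
rewrite pair_bigA/=.
rewrite (reindex (fun p : n.-tuple V * V => [tuple of rcons p.1 p.2]))/=.
  by apply: eq_bigr => -[w a] _ /=; rewrite hist_prob_rcons mulrA.
apply: onW_bij; apply: inj_card_bij; last first.
  by rewrite card_prod !card_tuple expnSr.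
by move=> [w a] [w' a'] /(congr1 val)/rcons_inj[/val_inj -> ->].
Qed.

Hypothesis ell01 : forall t v, (t < T)%N -> 0 <= ell t v <= 1.
Hypothesis U1_size : forall k, inU1 B k -> bsize B k = 1%N.
Hypothesis valid : valid_parameters T P.
Hypothesis run : is_run E T ell P S.

Lemma inU2E k : inU2 B k = ~~ inU1 B k. Proof. by rewrite /inU1 -leqNgt. Qed.

Lemma iterates_simplex h : (size h <= T)%N -> 0 < prob h ->
  simplex (Y h) /\ forall k, inU2 B k -> simplex (X h k).
Proof.
have [[Y0 X0] _ st] := run.
case/lastP: h => [|h a] hT hp.
  by split=> [|k /X0[]//]; case: Y0.
rewrite size_rcons in hT; have [[? _ _] Xs] := st h a hT hp.
by split=> // k /Xs[].
Qed.

Section Round.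
Variable h : seq V.
Hypotheses (hT : (size h < T)%N) (hp : 0 < prob h).

Lemma gglob_total_ge0 : 0 <= gglob_total P (size h).
Proof.
have [_ _ g _ _] := valid.
apply: sumr_ge0 => k _; apply: sumr_ge0 => j _.
by have /andP[] := g _ (arm B j) hT.
Qed.

Lemma gloc_total_ge0 k : inU2 B k -> 0 <= gloc_total P (size h) k.
Proof.
have [_ _ _ g _] := valid.
by move=> kU2; apply: sumr_ge0 => j _; have /andP[] := g _ _ j hT kU2.
Qed.

Lemma Xtilde_ge0 k (j : 'I_(bsize B k)) : 0 <= Xtilde P S h j.
Proof.
rewrite /Xtilde; case: ifPn; rewrite ?ler01// -inU2E => kU2.
have [_ _ _ g /(_ _ hT)[_ /(_ _ kU2) gl]] := valid.
have [_ /(_ _ kU2)[X0 _]] := iterates_simplex (ltnW hT) hp.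
by rewrite addr_ge0 ?mulr_ge0 ?subr_ge0//; have /andP[] := g _ _ j hT kU2.
Qed.

Lemma sum_U1 k (j : 'I_(bsize B k)) (f : 'I_(bsize B k) -> R) :
  inU1 B k -> \sum_i f i = f j.
Proof.
move=> /U1_size k1; rewrite (bigD1 j)//= big1 ?addr0// => i /eqP[].
apply: val_inj => /=; have := ltn_ord i; have := ltn_ord j.
rewrite [M in (j < M)%N]k1 [M in (i < M)%N]k1 !ltnS !leqn0.
by move=> /eqP -> /eqP ->.
Qed.

Lemma sum_Xtilde k : \sum_(j < bsize B k) Xtilde P S h j = 1.
Proof.
have [kU1|] := boolP (inU1 B k).
  have k0 : (0 < bsize B k)%N by rewrite U1_size.
  by rewrite (sum_U1 (Ordinal k0))// /Xtilde kU1.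
rewrite /Xtilde => kU1; rewrite (negbTE kU1) big_split/= -mulr_sumr.
have [_ /(_ k)[|_ ->]] := iterates_simplex (ltnW hT) hp; first by rewrite inU2E.
by rewrite mulr1 subrK.
Qed.

Lemma Z_arm k (j : 'I_(bsize B k)) :
  Z h (arm B j) = (1 - gglob_total P (size h)) * Y h 0 k * Xtilde P S h j
                  + gglob P (size h) (arm B j).
Proof. by rewrite /Defs.Z armK. Qed.

Lemma Z_ge0 v : 0 <= Z h v.
Proof.
have [_ _ g _ /(_ _ hT)[gl _]] := valid.
have [[Y0 _] _] := iterates_simplex (ltnW hT) hp.
rewrite addr_ge0 ?mulr_ge0 ?subr_ge0 ?Xtilde_ge0//.
by have /andP[] := g _ v hT.
Qed.

Lemma sum_Z : \sum_v Z h v = 1.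
Proof.
rewrite (sum_arms B).
under eq_bigr => k _.
  under eq_bigr => j _ do rewrite Z_arm.
  rewrite big_split/= -mulr_sumr sum_Xtilde mulr1.
  over.
have [[_ Y1] _] := iterates_simplex (ltnW hT) hp.
by rewrite big_split/= -mulr_sumr Y1 mulr1 subrK.
Qed.

(** The arms that reveal [v] are those of [Nin E v], and their total probability is the denominator
    of the estimator, nonzero along a run. *)
Lemma lhat_unbiased v : \sum_a Z h a * lhat E ell P S h a v = ell (size h) v.
Proof.
have [_ /(_ h v hT hp) nz _] := run.
rewrite /lhat; set s := \sum_(u in _) _ in nz *.
transitivity (\sum_(a in Nin E v) Z h a * (s^-1 * ell (size h) v)).
  rewrite [RHS]big_mkcond/=; apply: eq_bigr => a _; rewrite !inE.
  by case: ifP => _; rewrite ?mul1r// !mul0r mulr0.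
by rewrite -mulr_suml -/s mulrA divff// mul1r.
Qed.

Definition block_loss k : R :=
  \sum_(j < bsize B k) Xtilde P S h j * ell (size h) (arm B j).

Lemma Lhat_unbiased k : \sum_a Z h a * Lhat E ell P S h a 0 k = block_loss k.
Proof.
under eq_bigr do rewrite mxE mulr_sumr.
rewrite exchange_big; apply: eq_bigr => j _ /=.
rewrite -(lhat_unbiased (arm B j)) mulr_sumr.
by apply: eq_bigr => a _; rewrite mulrCA.
Qed.

Lemma sum_dotv n (y : 'rV[R]_n) (f : V -> 'rV[R]_n) :
  \sum_a Z h a * dotv y (f a) = \sum_i y 0 i * \sum_a Z h a * f a 0 i.
Proof.
under eq_bigr do rewrite /dotv mulr_sumr.
rewrite exchange_big; apply: eq_bigr => i _ /=; rewrite mulr_sumr.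
by apply: eq_bigr => a _; rewrite mulrCA.
Qed.

Lemma sum_simplex_delta n (y : 'rV[R]_n) (c : 'I_n -> R) i :
  \sum_i' (y - delta_mx 0 i) 0 i' * c i' = \sum_i' y 0 i' * c i' - c i.
Proof.
under eq_bigr do rewrite !mxE mulrBl.
rewrite big_split/= sumrN; congr (_ - _).
rewrite (bigD1 i)//= big1 => [|i' ii'].
  by rewrite !eqxx mul1r addr0.
by rewrite (negbTE ii') mul0r.
Qed.

Lemma dotv_Lhat' a k :
  dotv (Y h - delta_mx 0 k) (Lhat' E ell P S h a) =
  dotv (Y h - delta_mx 0 k) (Lhat E ell P S h a).
Proof.
rewrite /Lhat' dotvBr dotvZr [M in _ * M](_ : _ = 0) ?mulr0 ?subr0//.
rewrite /dotv sum_simplex_delta.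
under eq_bigr do rewrite mxE mulr1.
by have [[_ ->] _] := iterates_simplex (ltnW hT) hp; rewrite mxE subrr.
Qed.

(** The iterate depends on the past only, so averaging the estimators over the played arm yields
    true block losses, compared here with the vertex [k] of the simplex. *)
Lemma Y_round k :
  \sum_a Z h a * dotv (Y h - delta_mx 0 k) (Lhat' E ell P S h a) =
  \sum_k' Y h 0 k' * block_loss k' - block_loss k.
Proof.
under eq_bigr do rewrite dotv_Lhat'.
rewrite sum_dotv.
under eq_bigr do rewrite Lhat_unbiased.
exact: sum_simplex_delta.
Qed.

Lemma X_round k (j : 'I_(bsize B k)) :
  \sum_a Z h a * dotv (X h k - delta_mx 0 j) (lhat_block E ell P S h a k) =
  \sum_i X h k 0 i * ell (size h) (arm B i) - ell (size h) (arm B j).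
Proof.
rewrite sum_dotv.
under eq_bigr => i _.
  under eq_bigr do rewrite mxE.
  rewrite lhat_unbiased.
  over.
exact: sum_simplex_delta.
Qed.

Lemma loss_round :
  \sum_a Z h a * ell (size h) a <=
  \sum_k Y h 0 k * block_loss k + gglob_total P (size h).
Proof.
have [_ _ g _ _] := valid.
have [[Y0 _] _] := iterates_simplex (ltnW hT) hp.
rewrite (sum_arms B) -big_split/=; apply: ler_sum => k _.
rewrite /block_loss mulr_sumr -big_split/=; apply: ler_sum => j _.
rewrite Z_arm mulrDl; have /andP[l0 l1] := ell01 (arm B j) hT.
have /andP[g0 g1] := g _ (arm B j) hT.
apply: lerD; last by rewrite ler_piMr.
rewrite -!mulrA ler_piMl ?gerBl ?gglob_total_ge0//.
by rewrite !mulr_ge0 ?Xtilde_ge0.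
Qed.

Lemma block_loss_U1 k (j : 'I_(bsize B k)) : inU1 B k ->
  block_loss k = ell (size h) (arm B j).
Proof.
by move=> kU1; rewrite /block_loss (sum_U1 j)// /Xtilde kU1 mul1r.
Qed.

(** Same argument as for [loss_round], with the local exploration of one block. *)
Lemma block_loss_U2 k : inU2 B k ->
  block_loss k <=
  \sum_(j < bsize B k) X h k 0 j * ell (size h) (arm B j)
  + gloc_total P (size h) k.
Proof.
move=> kU2; have [_ _ _ g _] := valid.
have [_ /(_ _ kU2)[X0 _]] := iterates_simplex (ltnW hT) hp.
rewrite /block_loss -big_split/=; apply: ler_sum => j _.
rewrite /Xtilde; move: (kU2); rewrite inU2E => /negbTE ->.
have /andP[l0 l1] := ell01 (arm B j) hT; have /andP[g0 g1] := g _ _ j hT kU2.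
rewrite mulrDl; apply: lerD; last by rewrite ler_piMr.
by rewrite -mulrA ler_piMl ?gerBl ?gloc_total_ge0// mulr_ge0.
Qed.

End Round.

(** * Expectations over histories *)

(** The sign of [Z] is known only after histories of positive probability; after a null one the
    product is 0 anyway. *)
Lemma hist_prob_ge0 h : (size h <= T)%N -> 0 <= prob h.
Proof.
elim/last_ind: h => [_|h a IH]; first by rewrite hist_prob_nil ler01.
rewrite size_rcons hist_prob_rcons => hT.
have := IH (ltnW hT); rewrite le_eqVlt => /orP[/eqP <-|hp]; 
  first by rewrite mul0r.
by rewrite mulr_ge0 ?Z_ge0// ltW.
Qed.

Lemma hist_prob_take n h : (size h <= T)%N -> 0 < prob h -> 0 < prob (take n h).
Proof.
elim/last_ind: h => [|h a IH] //; rewrite size_rcons hist_prob_rcons => hT hp.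
have hp' : 0 < prob h.
  rewrite lt_neqAle hist_prob_ge0 1?ltnW// andbT.
  by apply: contraTneq hp => <-; rewrite mul0r ltxx.
rewrite -cats1 take_cat; case: ltnP => _; first exact: IH (ltnW hT) hp'.
case: (n - size h)%N => [|?] /=; first by rewrite cats0.
by rewrite cats1 hist_prob_rcons.
Qed.

(** The arms after round [t] are summed out one at a time, since [Z] has total mass 1 after each
    history of positive probability. *)
Lemma mean_take n t g : (t <= n <= T)%N ->
  mean n (fun w => g (take t w)) = mean t g.
Proof.
elim: n => [|n IH] /andP[tn nT].
  move: tn; rewrite leqn0 => /eqP ->; apply: eq_bigr => w _.
  by rewrite take0 tuple0.
move: tn; rewrite leq_eqVlt ltnS => /orP[/eqP ->|tn].
  by apply: eq_bigr => w _; rewrite take_oversize// size_tuple.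
rewrite mean_rcons; transitivity (mean n (fun w => g (take t w))); last first.
  by apply: IH; rewrite tn ltnW.
apply: eq_bigr => w _.
have wT : (size w < T)%N by rewrite size_tuple.
have := hist_prob_ge0 (ltnW wT); rewrite le_eqVlt => /orP[/eqP <-|wp].
  by rewrite !mul0r.
congr (_ * _); under eq_bigr do rewrite -cats1 takel_cat ?size_tuple//.
by rewrite -mulr_suml sum_Z// mul1r.
Qed.

Lemma mean_cst n c : (n <= T)%N -> mean n (fun=> c) = c.
Proof.
move=> nT; rewrite (@mean_take n 0 (fun=> c))// /mean.
rewrite (bigD1 [tuple])//= big1 => [|w /eqP[]]; last by rewrite tuple0.
by rewrite addr0 hist_prob_nil mul1r.
Qed.

(** Using [nth] lets the index be a natural number; as [t < T], the default [a0] is never read. *)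
Lemma mean_round a0 t (f : seq V -> V -> R) : (t < T)%N ->
  mean T (fun w => f (take t w) (nth a0 w t)) =
  mean t (fun h => \sum_a Z h a * f h a).
Proof.
move=> tT.
(* [g] sees only the first [t.+1] arms, so the later rounds can be cut off. *)
pose g w := f (take t w) (nth a0 w t).
transitivity (mean T (fun w => g (take t.+1 w))).
  by apply: eq_bigr => w _; rewrite /g take_takel// nth_take.
rewrite mean_take ?tT ?leqnn// mean_rcons; apply: eq_bigr => w _; congr (_ * _).
apply: eq_bigr => a _; rewrite /g -cats1 take_size_cat ?size_tuple//.
by rewrite nth_cat size_tuple ltnn subnn.
Qed.

Lemma mean_le n g g' : (n <= T)%N ->
  (forall w, size w = n -> 0 < prob w -> g w <= g' w) -> mean n g <= mean n g'.
Proof.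
move=> nT gg'; apply: ler_sum => w _.
have := @hist_prob_ge0 w; rewrite size_tuple => /(_ nT).
rewrite le_eqVlt => /orP[/eqP <-|wp]; first by rewrite !mul0r.
by rewrite ler_pM2l// gg'// size_tuple.
Qed.

Lemma tuple_prob_ge0 (w : T.-tuple V) : 0 <= prob w.
Proof. by apply: hist_prob_ge0; rewrite size_tuple. Qed.

Lemma sum_prob : \sum_(w : T.-tuple V) prob w = 1.
Proof.
rewrite -[RHS](mean_cst 1 (leqnn T)).
by apply: eq_bigr => w _; rewrite mulr1.
Qed.

Lemma expect_EFin (g : seq V -> R) :
  expect P S (fun w : T.-tuple V => (g w)%:E) = (mean T g)%:E.
Proof. by rewrite -sumEFin; apply: eq_bigr => w _; rewrite EFinM. Qed.

Lemma expect_le (f g : T.-tuple V -> \bar R) :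
  (forall w : T.-tuple V, 0 < prob w -> (f w <= g w)%E) ->
  (expect P S f <= expect P S g)%E.
Proof.
move=> fg; apply: lee_sum => w _.
have := tuple_prob_ge0 w; rewrite le_eqVlt => /orP[/eqP <-|wp].
  by rewrite !mul0e.
by apply: lee_wpmul2l; [rewrite lee_fin ltW|exact: fg].
Qed.

Lemma expect_ge0 (f : T.-tuple V -> \bar R) : (forall w, 0 <= f w)%E ->
  (0 <= expect P S f)%E.
Proof.
move=> f0; apply: sume_ge0 => w _.
by rewrite mule_ge0// lee_fin tuple_prob_ge0.
Qed.

Lemma expect_cst (c : \bar R) : expect P S (fun _ : T.-tuple V => c) = c.
Proof.
rewrite /expect -ge0_sume_distrl => [|w _]; last first.
  by rewrite lee_fin tuple_prob_ge0.
by rewrite sumEFin sum_prob mul1e.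
Qed.

Lemma expectD (f g : T.-tuple V -> \bar R) :
  (forall w, 0 <= f w)%E -> (forall w, 0 <= g w)%E ->
  (expect P S (fun w => f w + g w) = expect P S f + expect P S g)%E.
Proof.
move=> f0 g0; rewrite /expect -big_split/=; apply: eq_bigr => w _.
by rewrite ge0_muleDr.
Qed.

(** Carries the expectation into a pathwise bound. Nonnegativity of all terms makes this legitimate
    although [c], a diameter, and the suprema may be infinite. *)
Lemma expect_affine (c : \bar R) (d : R) (s : 'I_T -> T.-tuple V -> \bar R) :
  (0 <= c)%E -> (forall t w, 0 <= s t w)%E -> 0 <= d ->
  (expect P S (fun w => c + d%:E * \sum_t s t w)
    = c + d%:E * \sum_t expect P S (s t))%E.
Proof.
move=> c0 s0 d0; rewrite expectD// => [|w]; last first.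
  by rewrite mule_ge0 ?lee_fin// sume_ge0.
rewrite expect_cst; congr (_ + _)%E.
rewrite /expect exchange_big/= ge0_sume_distrr => [|w _]; last first.
  by apply: sume_ge0 => t _; rewrite mule_ge0// lee_fin tuple_prob_ge0.
apply: eq_bigr => w _; rewrite muleCA; congr (_ * _)%E.
by rewrite ge0_sume_distrr.
Qed.

Lemma mean_sum n (I : finType) (f : I -> seq V -> R) :
  mean n (fun w => \sum_i f i w) = \sum_i mean n (f i).
Proof.
by rewrite /mean; under eq_bigr do rewrite mulr_sumr; exact: exchange_big.
Qed.

(** A comparison of conditional means in each round suffices. It replaces the true regret by an
    estimated one, [G], to which pathwise bounds apply. *)
Lemma regret_le (G : seq V -> V -> R) a :
  (forall h, (size h < T)%N -> 0 < prob h ->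
    \sum_b Z h b * ell (size h) b - ell (size h) a <= \sum_b Z h b * G h b) ->
  (regret T ell P S a <=
    expect P S (fun w : T.-tuple V =>
      (\sum_(t < T) G (take t w) (tnth w t))%:E))%E.
Proof.
move=> hG.
have path (f : nat -> seq V -> V -> R) :
    expect P S (fun w : T.-tuple V =>
      (\sum_(t < T) f t (take t w) (tnth w t))%:E) =
    (\sum_(t < T) mean t (fun h => \sum_b Z h b * f t h b))%:E.
  under eq_fun => w do under eq_bigr do rewrite (tnth_nth a).
  rewrite (expect_EFin (fun w => \sum_(t < T) f t (take t w) (nth a w t))).
  rewrite mean_sum; congr EFin; apply: eq_bigr => t _.
  exact: mean_round.
rewrite /regret (path (fun t _ b => ell t b)) (path (fun _ => G)).
rewrite -EFinB lee_fin -sumrB; apply: ler_sum => t _.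
have tT := ltn_ord t.
rewrite -[ell t a](mean_cst (ell t a) (ltnW tT)).
rewrite [leLHS](_ : _ = mean t (fun h => \sum_b Z h b * ell t b - ell t a)).
  2: by rewrite /mean -sumrB; apply: eq_bigr => w _; rewrite mulrBr.
apply: (mean_le (ltnW tT)) => h ht hp.
by have := hG h; rewrite ht; apply.
Qed.

(** * Mirror descent along a history of positive probability *)

Lemma path_take (w : T.-tuple V) (a0 : V) t : 0 < prob w -> (t < T)%N ->
  [/\ (size (take t w) < T)%N, take t.+1 w = rcons (take t w) (nth a0 w t) &
      0 < prob (rcons (take t w) (nth a0 w t))].
Proof.
move=> wp tT; have tw : (t < size w)%N by rewrite size_tuple.
rewrite -(take_nth _ tw) size_take tw; split=> //.
by apply: hist_prob_take => //; rewrite size_tuple.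
Qed.

(** Once the history [om] is fixed, iterates and losses are ordinary sequences indexed by the round.
    All prefixes of [om] have positive probability, so every step is an actual minimization. *)
Lemma mirror_descent_path n (F : 'rV[R]_n -> \bar R) (eta : R)
    (it : seq V -> 'rV[R]_n) (w l : seq V -> V -> 'rV[R]_n) u
    (om : T.-tuple V) : V -> potential F -> invertible_hessian F -> 0 < eta ->
  is_argmin simplex F (it [::]) ->
  (forall h a, (size h < T)%N -> 0 < prob (rcons h a) ->
     is_argmin simplex (step_objective F eta (l h a) (it h)) (it (rcons h a)) /\
     is_argmin (interior (dom F)) (step_objective F eta (l h a) (it h)) (w h a))
  -> simplex u -> 0 < prob om ->
  ((\sum_(t < T) dotv (it (take t om) - u) (l (take t om) (tnth om t)))%:E <=
   diam F simplex * (eta^-1)%:E + (eta / 2)%:E * \sum_(t < T)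
     sup_sqnorm F (l (take t om) (tnth om t)) (w (take t om) (tnth om t))
       (it (take t om)))%E.
Proof.
move=> a0 pF iF eta0 it0 st su omp.
under eq_bigr do rewrite (tnth_nth a0).
under [in leRHS]eq_bigr do rewrite (tnth_nth a0).
apply: (mirror_descent_regret (x := fun t => it (take t om))
  (w := fun t => w (take t om) (nth a0 om t))
  (l := fun t => l (take t om) (nth a0 om t)) pF iF _ eta0) => //.
- exact: simplex_convex.
- by rewrite take0.
- move=> t tT; have [h1 -> h2] := path_take a0 omp tT.
  by have [] := st _ _ h1 h2.
- move=> t tT; have [h1 _ h2] := path_take a0 omp tT.
  by have [] := st _ _ h1 h2.
Qed.

Lemma Y_path (W : seq V -> V -> 'rV[R]_m) k (w : T.-tuple V) :
  V -> invertible_hessian (Psi P) -> is_W E T ell P S W -> 0 < prob w ->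
  ((\sum_(t < T) dotv (Y (take t w) - delta_mx 0 k)
       (Lhat' E ell P S (take t w) (tnth w t)))%:E <=
   diam (Psi P) simplex + 2^-1%:E * \sum_(t < T)
     sup_sqnorm (Psi P) (Lhat' E ell P S (take t w) (tnth w t))
       (W (take t w) (tnth w t)) (Y (take t w)))%E.
Proof.
move=> a0 iH WP wp; have [pP _ _ _ _] := valid; have [[Y0 _] _ st] := run.
have obj h a : step_objective (Psi P) 1 (Lhat' E ell P S h a) (Y h)
    = Y_objective E ell P S h a.
  by apply/funext => y; rewrite /step_objective mul1r.
have := @mirror_descent_path _ (Psi P) 1 Y W (Lhat' E ell P S) (delta_mx 0 k) w
  a0 pP iH ltr01 Y0.
rewrite invr1 mule1 div1r; apply=> //; last exact: simplex_delta.
move=> h a hT hp; rewrite obj; by split; [have [] := st h a hT hp|exact: WP].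
Qed.

Lemma X_path k (Q : seq V -> V -> 'rV[R]_(bsize B k)) (j : 'I_(bsize B k))
    (w : T.-tuple V) :
  inU2 B k -> invertible_hessian (Phi P k) -> is_Q E T ell P S Q ->
  0 < prob w ->
  ((\sum_(t < T) dotv (X (take t w) k - delta_mx 0 j)
       (lhat_block E ell P S (take t w) (tnth w t) k))%:E <=
   diam (Phi P k) simplex * ((eta P k)^-1)%:E
   + (eta P k / 2)%:E * \sum_(t < T)
     sup_sqnorm (Phi P k) (lhat_block E ell P S (take t w) (tnth w t) k)
       (Q (take t w) (tnth w t)) (X (take t w) k))%E.
Proof.
move=> kU2 iH QP wp; have [_ /(_ _ kU2)[pP eta0] _ _ _] := valid.
have [[_ X0] _ st] := run.
apply: (mirror_descent_path (it := fun h => X h k)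
  (l := fun h a => lhat_block E ell P S h a k) (arm B j) pP iH eta0) => //.
- exact: X0.
- move=> h a hT hp; split; last exact: QP.
  by have [_ /(_ _ kU2)] := st h a hT hp.
- exact: simplex_delta.
Qed.

(** * Assembly of the two regret bounds *)

Lemma diam_ge0 n (F : 'rV[R]_n -> \bar R) (x : 'rV[R]_n) :
  potential F -> is_argmin simplex F x -> (0 <= diam F simplex)%E.
Proof.
move=> pF [Kx Fx _]; apply: le_trans (diam_ge F Kx Kx).
by rewrite (dom_fine pF Fx) -EFinB subrr.
Qed.

Lemma gglob_totalE t : (\sum_(k < m) \sum_(j < bsize B k)
  (gglob P t (arm B j))%:E)%E = (gglob_total P t)%:E.
Proof. by rewrite -sumEFin; apply: eq_bigr => k _; rewrite sumEFin. Qed.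

Lemma sum_gglob_ge0 : 0 <= \sum_(t < T) gglob_total P t.
Proof.
have [_ _ g _ _] := valid; apply: sumr_ge0 => t _; apply: sumr_ge0 => k _.
by apply: sumr_ge0 => j _; have /andP[] := g t (arm B j) (ltn_ord t).
Qed.

Lemma sum_gloc_ge0 k : inU2 B k -> 0 <= \sum_(t < T) gloc_total P t k.
Proof.
move=> kU2; have [_ _ _ g _] := valid; apply: sumr_ge0 => t _.
by apply: sumr_ge0 => j _; have /andP[] := g t k j (ltn_ord t) kU2.
Qed.

(** The block has a single arm, so its loss is that of the comparator, and only the upper level
    contributes regret. *)
Lemma regret_U1 (W : seq V -> V -> 'rV[R]_m) k (j : 'I_(bsize B k)) :
  invertible_hessian (Psi P) -> is_W E T ell P S W -> inU1 B k ->
  (regret T ell P S (arm B j) <=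
      diam (Psi P) simplex
      + \sum_(t < T)
          (2^-1%:E * expect_round P S t (fun h a =>
             sup_sqnorm (Psi P) (Lhat' E ell P S h a) (W h a) (Y h))
           + \sum_(k' < m) \sum_(j' < bsize B k')
               (gglob P t (arm B j'))%:E))%E.
Proof.
move=> iH WP kU1; have [pP _ _ _ _] := valid; have [[Y0 _] _ _] := run.
pose G h a := dotv (Y h - delta_mx 0 k) (Lhat' E ell P S h a)
              + gglob_total P (size h).
apply: le_trans (@regret_le G _ _) _ => [h hT hp|].
  under [leRHS]eq_bigr do rewrite mulrDr.
  rewrite big_split/= -mulr_suml sum_Z// mul1r Y_round//.
  rewrite (block_loss_U1 _ j)// addrAC lerB//; exact: loss_round.
have s0 (t : 'I_T) (w : T.-tuple V) : (0 <= sup_sqnorm (Psi P)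
    (Lhat' E ell P S (take t w) (tnth w t)) (W (take t w) (tnth w t))
    (Y (take t w)))%E by exact: sup_sqnorm_ge0.
(* The deterministic terms are gathered so that the whole pathwise bound has the shape of
   [expect_affine]. *)
pose D := (diam (Psi P) simplex + (\sum_(t < T) gglob_total P t)%:E)%E.
apply: (@le_trans _ _ (expect P S (fun w : T.-tuple V => D + 2^-1%:E *
    \sum_(t < T) sup_sqnorm (Psi P) (Lhat' E ell P S (take t w) (tnth w t))
      (W (take t w) (tnth w t)) (Y (take t w)))%E)).
  apply: expect_le => w wp; rewrite /D addeAC big_split/= EFinD.
  apply: leeD; first exact: Y_path (arm B j) iH WP wp.
  rewrite lee_fin; apply: ler_sum => t _.
  by rewrite size_take size_tuple ltn_ord.
rewrite expect_affine ?invr_ge0//; last first.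
  by rewrite adde_ge0 ?lee_fin ?sum_gglob_ge0//; exact: diam_ge0 pP Y0.
rewrite /D -addeA big_split/= addeC [in leRHS]addeC; apply: leeD => //.
rewrite addeC -ge0_sume_distrr => [|t _]; last exact: expect_ge0.
by rewrite -sumEFin; under [in leRHS]eq_bigr do rewrite gglob_totalE.
Qed.

(** The upper level competes with block [k], the lower level with arm [j] inside it; [G] adds both
    estimated regrets and both exploration costs. *)
Lemma regret_U2 (W : seq V -> V -> 'rV[R]_m) k (j : 'I_(bsize B k))
    (Q : seq V -> V -> 'rV[R]_(bsize B k)) :
  invertible_hessian (Psi P) -> is_W E T ell P S W -> inU2 B k ->
  invertible_hessian (Phi P k) -> is_Q E T ell P S Q ->
  (regret T ell P S (arm B j) <=
      (diam (Psi P) simplex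
       + 2^-1%:E * \sum_(t < T) expect_round P S t (fun h a =>
           sup_sqnorm (Psi P) (Lhat' E ell P S h a) (W h a) (Y h)))
      + \sum_(t < T) \sum_(k' < m) \sum_(j' < bsize B k')
          (gglob P t (arm B j'))%:E
      + (diam (Phi P k) simplex * ((eta P k)^-1)%:E
         + (eta P k / 2)%:E * \sum_(t < T) expect_round P S t (fun h a =>
             sup_sqnorm (Phi P k) (lhat_block E ell P S h a k)
               (Q h a) (X h k)))
      + \sum_(t < T) \sum_(j' < bsize B k) (gloc P t j')%:E)%E.
Proof.
move=> iH WP kU2 iHk QP; have [pP /(_ _ kU2)[pPk eta0] _ _ _] := valid.
have [[Y0 /(_ _ kU2) X0] _ _] := run.
pose G h a := (dotv (Y h - delta_mx 0 k) (Lhat' E ell P S h a)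
               + gglob_total P (size h))
            + (dotv (X h k - delta_mx 0 j) (lhat_block E ell P S h a k)
               + gloc_total P (size h) k).
apply: le_trans (@regret_le G _ _) _ => [h hT hp|].
  under [leRHS]eq_bigr do rewrite !mulrDr.
  rewrite !big_split/= -!mulr_suml sum_Z// !mul1r Y_round// X_round//.
  (* The loss of block [k] is subtracted at the upper level and bounded at the lower one, so it
     cancels. *)
  have := loss_round hT hp; have := block_loss_U2 hT hp kU2.
  by lra.
have -> : (\sum_(t < T) \sum_(k' < m) \sum_(j' < bsize B k')
    (gglob P t (arm B j'))%:E = (\sum_(t < T) gglob_total P t)%:E)%E.
  by rewrite -sumEFin; apply: eq_bigr => t _; exact: gglob_totalE.
have -> : (\sum_(t < T) \sum_(j' < bsize B k) (gloc P t j')%:E =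
    (\sum_(t < T) gloc_total P t k)%:E)%E.
  by rewrite -sumEFin; apply: eq_bigr => t _; exact: sumEFin.
set g := (\sum_(t < T) _)%:E; set gk := (\sum_(t < T) _)%:E.
have g0 : (0 <= g)%E by rewrite lee_fin sum_gglob_ge0.
have gk0 : (0 <= gk)%E by rewrite lee_fin; exact: sum_gloc_ge0.
pose sY (t : 'I_T) (w : T.-tuple V) := sup_sqnorm (Psi P)
  (Lhat' E ell P S (take t w) (tnth w t)) (W (take t w) (tnth w t))
  (Y (take t w)).
pose sX (t : 'I_T) (w : T.-tuple V) := sup_sqnorm (Phi P k)
  (lhat_block E ell P S (take t w) (tnth w t) k) (Q (take t w) (tnth w t))
  (X (take t w) k).
have sY0 t w : (0 <= sY t w)%E by exact: sup_sqnorm_ge0.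
have sX0 t w : (0 <= sX t w)%E by exact: sup_sqnorm_ge0.
pose DY := diam (Psi P) simplex.
pose DX := (diam (Phi P k) simplex * ((eta P k)^-1)%:E)%E.
have DY0 : (0 <= DY)%E by exact: diam_ge0 pP Y0.
have DX0 : (0 <= DX)%E.
  apply: mule_ge0; first exact: diam_ge0 pPk X0.
  by rewrite lee_fin invr_ge0 ltW.
have h0 : 0 <= eta P k / 2 by rewrite divr_ge0// ltW.
(* The claimed bound is rewritten as the expectation of one pathwise bound; nonnegativity of both
   groups of terms allows the splitting even with infinite values. *)
have -> : (DY + 2^-1%:E * \sum_t expect P S (sY t) + g
    + (DX + (eta P k / 2)%:E * \sum_t expect P S (sX t)) + gk =
  expect P S (fun w => ((DY + g) + 2^-1%:E * \sum_t sY t w)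
    + ((DX + gk) + (eta P k / 2)%:E * \sum_t sX t w)))%E.
  rewrite expectD => [|w|w]; first last.
  - apply: adde_ge0; first exact: adde_ge0.
    by apply: mule_ge0 => //; exact: sume_ge0.
  - apply: adde_ge0; first exact: adde_ge0.
    by apply: mule_ge0; [rewrite lee_fin invr_ge0|exact: sume_ge0].
  rewrite !expect_affine ?invr_ge0 ?adde_ge0//.
  by rewrite -addeA (addeAC DX) (addeAC DY).
apply: expect_le => w wp; rewrite big_split/= EFinD.
rewrite (addeAC DX) (addeAC DY) !big_split/= !EFinD.
apply: leeD; apply: leeD.
- exact: Y_path (arm B j) iH WP wp.
- rewrite lee_fin; apply: ler_sum => t _.
  by rewrite size_take size_tuple ltn_ord.
- exact: X_path.
- rewrite lee_fin; apply: ler_sum => t _.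
  by rewrite size_take size_tuple ltn_ord.
Qed.

End Run.

Theorem theorem8 (R : realType) (V : finType) (E : rel V) (m : nat)
    (B : named_partition V m) (T : nat) (ell : nat -> V -> R)
    (P : osmd_params R B) (S : iterates R B)
    (W : seq V -> V -> 'rV[R]_m) (k : 'I_m) (j : 'I_(bsize B k)) :
  legal B E ->
  (forall t v, (t < T)%N -> 0 <= ell t v <= 1) ->
  valid_parameters T P ->
  is_run E T ell P S ->
  invertible_hessian (Psi P) ->
  is_W E T ell P S W ->
  (inU2 B k ->
   forall Q : seq V -> V -> 'rV[R]_(bsize B k),
   invertible_hessian (Phi P k) ->
   is_Q E T ell P S Q ->
   (regret T ell P S (arm B j) <=
      (diam (Psi P) simplex
       + 2^-1%:E * \sum_(t < T) expect_round P S t (fun h a =>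
           sup_sqnorm (Psi P) (Lhat' E ell P S h a) (W h a) (Yit S h)))
      + \sum_(t < T) \sum_(k' < m) \sum_(j' < bsize B k')
          (gglob P t (arm B j'))%:E
      + (diam (Phi P k) simplex * ((eta P k)^-1)%:E
         + (eta P k / 2)%:E * \sum_(t < T) expect_round P S t (fun h a =>
             sup_sqnorm (Phi P k) (lhat_block E ell P S h a k)
               (Q h a) (Xit S h k)))
      + \sum_(t < T) \sum_(j' < bsize B k) (gloc P t j')%:E)%E) /\
  (inU1 B k ->
   (regret T ell P S (arm B j) <=
      diam (Psi P) simplex
      + \sum_(t < T)
          (2^-1%:E * expect_round P S t (fun h a =>
             sup_sqnorm (Psi P) (Lhat' E ell P S h a) (W h a) (Yit S h))
           + \sum_(k' < m) \sum_(j' < bsize B k')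
               (gglob P t (arm B j'))%:E))%E).

Proof.
move=> [_ _ U1_size _ _] ell01 valid run iH WP; split=> [kU2 Q iHk QP|kU1].
  exact: (regret_U2 ell01 U1_size valid run).
exact: (regret_U1 ell01 U1_size valid run).
Qed.
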